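(* Let $p,q\ge2$ be coprime integers and let $c\in\mathbb{C}$ with $c\ne 2\cos\pi\left(\frac{ra}{p}\pm\frac{sb}{q}\right)$ for all pairs of integers $(a,b)$ with $0<a<p$, $0<b<q$, $a\equiv b\pmod 2$. Let $\varepsilon\in\{1,-1\}$ be the common sign of the adjoint Reidemeister torsions $\tau_{\mathrm{ad}\circ\rho}$ of the torus knot $K_{p,q}$ with respect to its meridian $\mu$. Let $m\ge -1$ be an integer. (i) If $p$ is odd, then $$\varepsilon^m\sum_{\substack{[\rho]\in\mathcal{X}_2^*\\ \mathrm{tr}\,\rho(\mu)=c}}(\tau_{\mathrm{ad}\circ\rho})^m=2^{-m}\,\mathrm{rank}\,V_p(\Sigma_{m+1})\cdot\mathrm{rank}\,V_{2q}(\Sigma_{m+1})\in\frac{1}{2^m}\mathbb{Z}.$$ (ii) In particular (for any coprime $p,q\ge 2$), $\displaystyle\sum_{\substack{[\rho]\in\mathcal{X}_2^*\\ \mathrm{tr}\,\rho(\mu)=c}}(2\tau_{\mathrm{ad}\circ\rho})^m\in\mathbb{Z}$. (iii) If $p$ and $q$ are both odd, then $$\varepsilon^m\sum_{\substack{[\rho]\in\mathcal{X}_2^*\\ \mathrm{tr}\,\rho(\mu)=c}}(\tau_{\mathrm{ad}\circ\rho})^m=2\,\mathrm{rank}\,V_p(\Sigma_{m+1})\cdot\mathrm{rank}\,V_q(\Sigma_{m+1})\in2\mathbb{Z}.$$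
   Context: $K_{p,q}\subset S^3$ is the torus knot of type $(p,q)$, $G_{p,q}=\langle x,y\mid x^p=y^q\rangle$ its group, and $\mu=x^{-r}y^s$ its meridian, where $(r,s)$ is a fixed pair of integers with $ps-qr=1$. $\mathcal{X}_2^*$ is the set of conjugacy classes (characters) of irreducible representations $\rho\colon G_{p,q}\to\mathrm{SL}_2(\mathbb{C})$. Known facts: $\mathcal{X}_2^*$ is the disjoint union of components $\mathcal{X}^*_{2,(a,b)}$ indexed by integer pairs with $0<a<p$, $0<b<q$, $a\equiv b\pmod 2$; for $[\rho]\in\mathcal{X}^*_{2,(a,b)}$ one has $\mathrm{tr}\,\rho(x)=2\cos\frac{\pi a}{p}$, $\mathrm{tr}\,\rho(y)=2\cos\frac{\pi b}{q}$, $\rho(x^p)=\rho(y^q)=(-I)^a$, and $\mathrm{tr}\,\rho(\mu)\ne2\cos(\frac{\pi ra}{p}\pm\frac{\pi sb}{q})$; $\mathrm{tr}\,\rho(\mu)$ is a parameter on the component, so for $c$ as in the claim each component contains exactly one class with $\mathrm{tr}\,\rho(\mu)=c$. $\tau_{\mathrm{ad}\circ\rho}=\tau_{\mathrm{ad}\circ\rho}(K_{p,q},\mu)$ denotes the adjoint Reidemeister torsion, i.e. the torsion of the knot exterior with coefficients in $\mathfrak{sl}_2(\mathbb{C})$ via the adjoint representation $\mathrm{ad}\circ\rho$, with homology bases normalized by the curve $\mu$. Its known value on $\mathcal{X}^*_{2,(a,b)}$ is $$\tau_{\mathrm{ad}\circ\rho}=\varepsilon\,\frac{pq}{16\sin^2\frac{a\pi}{p}\sin^2\frac{b\pi}{q}},$$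 with a sign $\varepsilon=\pm1$ that is the same for all $[\rho]$; this may be taken as its definition. For $N\ge3$, $V_N(\Sigma_{k})$ denotes the module associated by the Kauffman-bracket TQFT of Blanchet--Habegger--Masbaum--Vogel to a closed surface $\Sigma_k$ of genus $k$ (equipped with the empty link). Its rank is a non-negative integer given by Verlinde's formula (known): for every integer $m\ge-1$, $$\mathrm{rank}\,V_N(\Sigma_{m+1})=\sum_{\substack{0<a<N\\ a\text{ even}}}\left(\frac{N}{4\sin^2\frac{a\pi}{N}}\right)^m .$$ *)

(* Defs.v *)
From HB Require Import structures.
From mathcomp Require Import all_boot all_order all_algebra.
From mathcomp Require Import complex.
From mathcomp Require Import all_classical all_reals all_analysis.

Set Implicit Arguments.
Unset Strict Implicit.
Unset Printing Implicit Defensive.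

Import Order.TTheory GRing.Theory Num.Theory.
Local Open Scope classical_set_scope.
Local Open Scope ring_scope.
Local Open Scope complex_scope.

(* A homomorphism rho : <x, y | x^p = y^q> -> SL_2(C) is the same thing as the
   pair (rho x, rho y) of elements of SL_2(C) satisfying the defining relation;
   C is R[i]. *)
Definition sl2_reps (R : realType) (p q : nat) :
    set ('M[R[i]]_2 * 'M[R[i]]_2) :=
  [set rho | [/\ \det rho.1 = 1, \det rho.2 = 1 & rho.1 ^+ p = rho.2 ^+ q]].

(* The only invariant subspaces of C^2 are 0 and C^2.  SL_2(C) acts on column
   vectors; since mathcomp subspaces are row spaces, with matrices acting on the
   right, the transposed matrices appear. *)
Definition irreducible_pair (R : realType)
    (rho : 'M[R[i]]_2 * 'M[R[i]]_2) : Prop :=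
  forall U : 'M[R[i]]_2,
    stablemx U rho.1^T -> stablemx U rho.2^T -> U = 0 \/ row_full U.

Definition irr_reps (R : realType) (p q : nat) :
    set ('M[R[i]]_2 * 'M[R[i]]_2) :=
  [set rho | sl2_reps p q rho /\ irreducible_pair rho].

Definition conj_class (R : realType) (rho : 'M[R[i]]_2 * 'M[R[i]]_2) :
    set ('M[R[i]]_2 * 'M[R[i]]_2) :=
  [set sigma | exists2 P : 'M[R[i]]_2, \det P = 1 &
     sigma = (P * rho.1 * P^-1, P * rho.2 * P^-1)].

(* rho(mu) for the meridian mu = x^-r y^s *)
Definition meridian_image (R : realType) (r s : int)
    (rho : 'M[R[i]]_2 * 'M[R[i]]_2) : 'M[R[i]]_2 :=
  rho.1 ^ (- r) * rho.2 ^ s.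

(* The elements [rho] of X_2^* with tr rho(mu) = c. *)
Definition classes_with_trace (R : realType) (p q : nat) (r s : int)
    (c : R[i]) : set (set ('M[R[i]]_2 * 'M[R[i]]_2)) :=
  [set conj_class rho | rho in
     [set rho | irr_reps p q rho /\ \tr (meridian_image r s rho) = c]].

Definition component_index (p q : nat) (ab : nat * nat) : Prop :=
  [/\ (0 < ab.1 < p)%N, (0 < ab.2 < q)%N & (ab.1 = ab.2 %[mod 2])%N].

(* X^*_{2,(a,b)}, cut out of X_2^* by the values of tr rho(x) and tr rho(y) *)
Definition component (R : realType) (p q : nat) (ab : nat * nat) :
    set (set ('M[R[i]]_2 * 'M[R[i]]_2)) :=
  [set conj_class rho | rho in
     [set rho | [/\ irr_reps p q rho,
        \tr rho.1 = (2 * cos (pi * ab.1%:R / p%:R))%:C &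
        \tr rho.2 = (2 * cos (pi * ab.2%:R / q%:R))%:C]]].

(* tau_{ad o rho}(K_{p,q}, mu) as a function of the class [rho]: it equals
   eps * p q / (16 sin^2(a pi / p) sin^2(b pi / q)) on X^*_{2,(a,b)}.  The
   components partition X_2^*, so xget picks the index (a,b) of the component
   containing [rho]; the default is never used on X_2^*. *)
Definition adjoint_torsion (R : realType) (eps : R[i]) (p q : nat)
    (X : set ('M[R[i]]_2 * 'M[R[i]]_2)) : R[i] :=
  let ab := xget (0%N, 0%N)
    [set ab | component_index p q ab /\ component p q ab X] in
  eps * (p%:R * q%:R / (16 * sin (ab.1%:R * pi / p%:R) ^+ 2
                           * sin (ab.2%:R * pi / q%:R) ^+ 2))%:C.

(* The right-hand side of Verlinde's formula for a surface of genus g; in the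
   exponent, g - 1 is an integer (equal to -1 when g = 0). *)
Definition verlinde (R : realType) (N g : nat) : R :=
  \sum_(1 <= a < N | ~~ odd a)
    (N%:R / (4 * sin (a%:R * pi / N%:R) ^+ 2)) ^ (g%:Z - 1).

(* rank V_N(Sigma_g): the natural number given by Verlinde's formula (N >= 3). *)
Definition rankV (R : realType) (N g : nat) : nat :=
  xget 0%N [set n : nat | n%:R = verlinde R N g].

(* Main.v *)
Require Import Defs.
From HB Require Import structures.
From mathcomp Require Import all_boot all_order all_algebra.
From mathcomp Require Import complex ring lra zify.
From mathcomp Require Import all_classical all_reals all_analysis.

Set Implicit Arguments.
Unset Strict Implicit.
Unset Printing Implicit Defensive.

Import Order.TTheory GRing.Theory Num.Theory.
Local Open Scope classical_set_scope.
Local Open Scope ring_scope.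
Local Open Scope complex_scope.

(** An irreducible pair (A, B) with A^p = B^q has non-commuting A and B, so by
    Cayley-Hamilton the Chebyshev polynomial U_(p-1) vanishes at tr A, whence
    tr A = 2 cos(pi a/p), and likewise for B.  The conjugacy class of an
    irreducible pair is determined by tr A, tr B and tr AB: in the basis (v, Bv)
    with v an eigenvector of A the pair takes a normal form depending only on
    these traces.  As tr rho(mu) is an affine function of tr AB, with slope
    nonzero because ps - qr = 1, each index (a, b) contributes one class, and
    the sum becomes a double sum over a = b mod 2.  When p is odd, a |-> p - a
    exchanges parities and decouples this double sum.

    Verlinde's sums are integral because, for sin(N x) = 0 and sin x <> 0,
      2N / (4 sin^2 x) = - sum_(k < N) k (N - k) cos(2 k x),
    so the sums over b of cos(2 j b pi/N) (2N / 4 sin^2(b pi/N))^n are integers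
    by induction on n.  For odd N every k (N - k) is even, and the symmetry
    k |-> N - k saves a further factor 2. *)

(** * Integrality of Verlinde's sums *)

Lemma sin_natpi (R : realType) (n : nat) : sin (n%:R * pi) = 0 :> R.
Proof.
elim: n => [|n IH]; first by rewrite mul0r sin0.
by rewrite -natr1 mulrDl mul1r sinDpi IH oppr0.
Qed.

Lemma cos_natpi (R : realType) (n : nat) : cos (n%:R * pi) = (-1) ^+ n :> R.
Proof.
elim: n => [|n IH]; first by rewrite mul0r cos0.
by rewrite -natr1 mulrDl mul1r cosDpi IH exprS mulN1r.
Qed.

Lemma sin_angle_gt0 (R : realType) (N b : nat) : (0 < b < N)%N ->
  0 < sin (b%:R * pi / N%:R) :> R.
Proof.
move=> /andP[b0 bN]; apply: sin_gt0_pi.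
have N0 : (0 : R) < N%:R by rewrite ltr0n; lia.
have pi0 := pi_gt0 R.
apply/andP; split; first by rewrite divr_gt0 // mulr_gt0 // ltr0n.
by rewrite ltr_pdivrMr // mulrC ltr_pM2l // ltr_nat.
Qed.

Lemma sin_mul_eq0 (R : realType) (x : R) (n : nat) :
  sin x = 0 -> sin (n%:R * x) = 0.
Proof.
move=> sx; elim: n => [|n IH]; first by rewrite mul0r sin0.
by rewrite -natr1 mulrDl mul1r sinD IH sx mulr0 mul0r addr0.
Qed.

Lemma cos_double_sin (R : realType) (x : R) :
  cos (2 * x) = 1 - 2 * sin x ^+ 2.
Proof. by rewrite mulr_natl cos_mulr2n cos2sin2 -mulr_natl; ring. Qed.

Lemma sin_double (R : realType) (x : R) :
  sin (2 * x) = 2 * sin x * cos x.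
Proof. by rewrite mulr_natl sin_mulr2n -mulr_natl; ring. Qed.

(** Since 2 sin x cos(2bx) = sin((2b+1)x) - sin((2b-1)x), the sum telescopes; the end b = 0
    contributes + sin x. *)
Lemma cos_sum_telescope (R : realType) (x : R) (n : nat) :
  2 * sin x * \sum_(0 <= b < n) cos (2 * (b%:R * x)) =
  sin ((2 * n%:R - 1) * x) + sin x.
Proof.
elim: n => [|n IH].
  by rewrite big_nil mulr0 mulr0 sub0r mulN1r sinN addNr.
rewrite big_nat_recr //= mulrDr IH -[n.+1%:R]natr1.
have -> : (2 * n%:R - 1) * x = 2 * (n%:R * x) - x by ring.
have -> : (2 * (n%:R + 1) - 1) * x = 2 * (n%:R * x) + x by ring.
rewrite sinB sinD; ring.
Qed.

(** With x = j pi/N the sum is N if sin x = 0. Otherwise (2N-1)x = 2j pi - x, so the telescoped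
    right-hand side cancels and the sum is 0. *)
Lemma cos_sum_int (R : realType) (N j : nat) : (0 < N)%N ->
  \sum_(0 <= b < N) cos (2 * (b%:R * (j%:R * pi / N%:R))) \is a @Num.int R.
Proof.
move=> N0; set x : R := j%:R * pi / N%:R.
have Nn0 : (N%:R : R) != 0 by rewrite pnatr_eq0 -lt0n.
have [sx|sx] := eqVneq (sin x) 0.
  rewrite (eq_bigr (fun=> 1)) => [|b _].
    by rewrite sumr_const_nat; apply: rpredMn; apply: rpred1.
  by rewrite cos_double_sin sin_mul_eq0 // expr0n mulr0 subr0.
suff -> : \sum_(0 <= b < N) cos (2 * (b%:R * x)) = 0 by apply: rpred0.
have /eqP := cos_sum_telescope x N.
have -> : (2 * N%:R - 1) * x = (2 * j)%:R * pi - x.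
  by rewrite /x natrM; field.
rewrite sinB sin_natpi cos_natpi exprM sqrrN expr1n expr1n.
rewrite mul0r mul1r sub0r addNr !mulf_eq0 (negPf sx) pnatr_eq0 /=.
by move/eqP.
Qed.

Lemma cos_sum1_int (R : realType) (N j : nat) : (0 < N)%N ->
  \sum_(1 <= b < N) cos (2 * (b%:R * (j%:R * pi / N%:R))) \is a @Num.int R.
Proof.
move=> N0; have := cos_sum_int R j N0.
by rewrite big_ltn // mul0r mulr0 cos0 rpredDl // rpred1.
Qed.

(** * Finite cosine expansion of the inverse squared sine *)

Section InverseSquareSine.
Variables (R : realType) (N : nat) (x : R).
Hypothesis N_gt0 : (0 < N)%N.

(** Summation by parts: multiplying by 2 - 2 cos 2x takes minus a second difference, and k (N - k)
    has constant second difference -2. The remaining terms come from the two ends of the range. *)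
Lemma quadratic_cos_partial_sum (n : nat) :
  (2 - 2 * cos (2 * x)) *
    \sum_(0 <= k < n) k%:R * (N%:R - k%:R) * cos (2 * (k%:R * x)) =
  2 * \sum_(0 <= k < n) cos (2 * (k%:R * x))
  - (n%:R - 1) * (N%:R - n%:R + 1) * cos (2 * (n%:R * x))
  + n%:R * (N%:R - n%:R) * cos (2 * (n%:R * x) - 2 * x) - (N%:R + 1).
Proof.
elim: n => [|n IH].
  by rewrite !big_nil !mul0r mulr0 cos0; ring.
rewrite !big_nat_recr //= !mulrDr IH -[n.+1%:R]natr1.
have -> : 2 * ((n%:R + 1) * x) - 2 * x = 2 * (n%:R * x) by ring.
have -> : 2 * ((n%:R + 1) * x) = 2 * (n%:R * x) + 2 * x by ring.
rewrite cosB cosD; ring.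
Qed.

Hypothesis sinx : sin x != 0.
Variable b : nat.
Hypothesis Nx : N%:R * x = b%:R * pi.

Let cosNx : cos (2 * (N%:R * x)) = 1.
Proof. by rewrite Nx cos_double_sin sin_natpi expr0n mulr0 subr0. Qed.

Let sinNx : sin (2 * (N%:R * x)) = 0.
Proof. by rewrite Nx sin_double sin_natpi mulr0 mul0r. Qed.

Lemma cos_sum0 : \sum_(0 <= k < N) cos (2 * (k%:R * x)) = 0.
Proof.
have /eqP := cos_sum_telescope x N.
have -> : (2 * N%:R - 1) * x = 2 * (N%:R * x) - x by ring.
rewrite sinB sinNx cosNx mul0r mul1r sub0r addNr.
by rewrite !mulf_eq0 (negPf sinx) pnatr_eq0 /= => /eqP.
Qed.

(** At n = N the end terms add up to -2N, the plain cosine sum vanishes, and 2 - 2 cos 2x = 4 sin^2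
    x. *)
Lemma quadratic_cos_sum :
  \sum_(0 <= k < N) k%:R * (N%:R - k%:R) * cos (2 * (k%:R * x)) =
  - (2 * N%:R / (4 * sin x ^+ 2)).
Proof.
have := quadratic_cos_partial_sum N.
rewrite cos_sum0 cosB cosNx sinNx cos_double_sin => H.
apply: (@mulfI _ (4 * sin x ^+ 2)).
  by rewrite mulf_neq0 ?expf_neq0 ?pnatr_eq0.
rewrite mulrN [in RHS]mulrC divfK ?mulf_neq0 ?expf_neq0 ?pnatr_eq0 //.
by rewrite (_ : 4 * _ = 2 - 2 * (1 - 2 * sin x ^+ 2)) ?H; ring.
Qed.

(** The reflection k |-> N - k keeps the weight k (N - k) and negates the sine. The zero term k = 0
    is removed first, so that the range is stable under the reflection. *)
Lemma quadratic_sin_sum :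
  \sum_(0 <= k < N) k%:R * (N%:R - k%:R) * sin (2 * (k%:R * x)) = 0.
Proof.
set S := \sum_(_ <= _ < _) _.
have S1 : S = \sum_(1 <= k < N) k%:R * (N%:R - k%:R) * sin (2 * (k%:R * x)).
  by rewrite /S big_ltn // !mul0r add0r.
suff : S = - S by lra.
rewrite S1 [LHS]big_nat_rev /= -sumrN.
apply: eq_big_nat => k /andP[k1 kN].
rewrite add1n subSS natrB; last by lia.
have -> : 2 * ((N%:R - k%:R) * x) = 2 * (N%:R * x) - 2 * (k%:R * x) by ring.
rewrite sinB cosNx sinNx; ring.
Qed.

(** This drives the induction on the exponent: a factor of inverse squared sine is traded for an
    integer combination of shifted cosines. *)
Lemma invsin2_mul_cos (y : R) :
  2 * N%:R / (4 * sin x ^+ 2) * cos y =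
  - \sum_(0 <= k < N) k%:R * (N%:R - k%:R) * cos (2 * (k%:R * x) + y).
Proof.
have -> : \sum_(0 <= k < N) k%:R * (N%:R - k%:R) * cos (2 * (k%:R * x) + y) =
  (\sum_(0 <= k < N) k%:R * (N%:R - k%:R) * cos (2 * (k%:R * x))) * cos y -
  (\sum_(0 <= k < N) k%:R * (N%:R - k%:R) * sin (2 * (k%:R * x))) * sin y.
  rewrite !mulr_suml -sumrB; apply: eq_bigr => k _.
  by rewrite cosD; ring.
by rewrite quadratic_sin_sum quadratic_cos_sum; ring.
Qed.

End InverseSquareSine.

(** Besides being the base of Verlinde's summand, it factors the torsion: on the component (a, b)
    the torsion is [eps] times the product of the terms for (p, a) and (q, b). *)
Definition verlinde_term (R : realType) (N b : nat) : R :=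
  N%:R / (4 * sin (b%:R * pi / N%:R) ^+ 2).

Lemma verlinde_term_sym (R : realType) (N b : nat) : (0 < b < N)%N ->
  verlinde_term R N (N - b) = verlinde_term R N b.
Proof.
move=> /andP[b0 bN]; rewrite /verlinde_term.
have Nn0 : (N%:R : R) != 0 by rewrite pnatr_eq0; lia.
have -> : (N - b)%:R * pi / N%:R = pi - b%:R * pi / N%:R :> R.
  by rewrite natrB 1?ltnW //; field.
by rewrite sinB sinpi cospi mul0r sub0r mulN1r opprK.
Qed.

Lemma sum_even_half (R : pzRingType) (N : nat) (F : nat -> R) : odd N ->
  (forall a, (0 < a < N)%N -> F (N - a)%N = F a) ->
  \sum_(1 <= a < N) F a = 2 * \sum_(1 <= a < N | ~~ odd a) F a.
Proof.
move=> oddN symF; rewrite (bigID odd) /= mulr_natl mulr2n; congr (_ + _).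
rewrite big_mkcond big_nat_rev /= -big_mkcond /= big_nat_cond [RHS]big_nat_cond.
apply: eq_big => [a|a /andP[aN _]]; last by rewrite add1n subSS symF.
case: (boolP (1 <= a < N)%N) => //= /andP[a1 aN].
by rewrite add1n subSS oddB ?(ltnW aN) // oddN.
Qed.

(** * Integrality of power sums of Verlinde terms *)

Section PowerSums.
Variables (R : realType) (N d : nat).
Hypothesis N_gt0 : (0 < N)%N.
Hypothesis d_gt0 : (0 < d)%N.
Hypothesis d_dvd : forall k, (k < N)%N -> (d %| k * (N - k))%N.

(** The common divisor [d] of the weights k (N - k) will be 1 for general N, and 2 for odd N, where
    [E b] is then the Verlinde term itself. *)
Let E (b : nat) : R := 2 * verlinde_term R N b / d%:R.
Let coef (k : nat) : R := (k * (N - k) %/ d)%N%:R.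

Lemma scaled_term_mul_cos (b : nat) (y : R) : (0 < b < N)%N ->
  E b * cos y =
  - \sum_(0 <= k < N) coef k * cos (2 * (k%:R * (b%:R * pi / N%:R)) + y).
Proof.
move=> bN.
have Nn0 : (N%:R : R) != 0 by rewrite pnatr_eq0 -lt0n.
have dn0 : (d%:R : R) != 0 by rewrite pnatr_eq0 -lt0n.
have sx : sin (b%:R * pi / N%:R) != 0 :> R by rewrite gt_eqF ?sin_angle_gt0.
have Nx : N%:R * (b%:R * pi / N%:R) = b%:R * pi :> R by field.
have H := invsin2_mul_cos N_gt0 sx Nx y.
have -> : E b * cos y = (2 * N%:R / (4 * sin (b%:R * pi / N%:R) ^+ 2) * cos y) / d%:R.
  by rewrite /E /verlinde_term; field; rewrite dn0 sx.
rewrite H mulNr mulr_suml; congr (- _); apply: eq_big_nat => k /andP[_ kN].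
rewrite /coef.
have -> : k%:R * (N%:R - k%:R) = (k * (N - k) %/ d)%N%:R * d%:R :> R.
  by rewrite -natrM divnK ?d_dvd // natrM natrB // ltnW.
by field.
Qed.

(** The cosine twist closes the induction: raising the exponent by one only shifts the frequency
    j. *)
Let twisted_sum (n j : nat) : R :=
  \sum_(1 <= b < N) cos (2 * (b%:R * (j%:R * pi / N%:R))) * E b ^+ n.

Lemma twisted_power_sumS (n j : nat) :
  twisted_sum n.+1 j = - \sum_(0 <= k < N) coef k * twisted_sum n (k + j).
Proof.
rewrite /twisted_sum; under [in RHS]eq_bigr do rewrite mulr_sumr.
rewrite exchange_big /= -sumrN; apply: eq_big_nat => b bN.
rewrite exprS mulrA [cos _ * _]mulrC scaled_term_mul_cos // mulNr mulr_suml.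
congr (- _); apply: eq_bigr => k _; rewrite [in RHS]mulrA; congr (_ * _ * _).
by congr cos; rewrite natrD; ring.
Qed.

Lemma twisted_power_sum_int (n j : nat) : twisted_sum n j \is a @Num.int R.
Proof.
elim: n j => [|n IH] j.
  rewrite /twisted_sum; under eq_bigr do rewrite expr0 mulr1.
  exact: cos_sum1_int.
rewrite twisted_power_sumS rpredN; apply: rpred_sum => k _.
by rewrite rpredM // rpred_nat.
Qed.

Lemma power_sumE (n : nat) : \sum_(1 <= b < N) E b ^+ n = twisted_sum n 0.
Proof.
by apply: eq_bigr => b _; rewrite !mul0r !mulr0 cos0 mul1r.
Qed.

Lemma power_sum_int (n : nat) : \sum_(1 <= b < N) E b ^+ n \is a @Num.int R.
Proof. by rewrite power_sumE twisted_power_sum_int. Qed.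

(** The full sum is twice its even part. Expanding one factor [E b] gives a sum over k that is
    symmetric under k |-> N - k as well, hence also twice its even part; the factors 2 cancel.
    Exponent 0 has no factor to expand and is treated apart. *)
Lemma power_sum_half_int (n : nat) : odd N ->
  \sum_(1 <= b < N | ~~ odd b) E b ^+ n \is a @Num.int R.
Proof.
move=> oddN; case: n => [|n]; first by rewrite rpred_sum // => b _; rewrite rpred1.
suff -> : \sum_(1 <= b < N | ~~ odd b) E b ^+ n.+1 =
    - \sum_(1 <= k < N | ~~ odd k) coef k * twisted_sum n k.
  rewrite rpredN rpred_sum // => k _.
  by rewrite rpredM ?rpred_nat ?twisted_power_sum_int.
apply: (@mulfI _ 2); first by rewrite pnatr_eq0.
rewrite mulrN -!sum_even_half //; first last.
- by move=> b bN; rewrite /E verlinde_term_sym.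
(* Replacing k by N - k turns the angle into 2b pi minus itself, which preserves the cosine. *)
- move=> k /andP[k0 kN]; rewrite /coef subKn; last exact: ltnW.
  rewrite [((N - k) * k)%N]mulnC; congr (_ * _); apply: eq_bigr => b _.
  congr (_ * _).
  have Nn0 : (N%:R : R) != 0 by rewrite pnatr_eq0 -lt0n.
  have -> : 2 * (b%:R * ((N - k)%:R * pi / N%:R)) =
            (2 * b)%:R * pi - 2 * (b%:R * (k%:R * pi / N%:R)) :> R.
    by rewrite natrB ?natrM; [field | exact: ltnW].
  rewrite cosB sin_natpi cos_natpi exprM sqrrN !expr1n.
  by rewrite mul1r mul0r addr0.
rewrite power_sumE twisted_power_sumS big_ltn // /coef mul0n div0n mul0r add0r.
by under eq_bigr do rewrite addn0.
Qed.

End PowerSums.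

Lemma verlinde_term_gt0 (R : realType) (N b : nat) : (0 < b < N)%N ->
  0 < verlinde_term R N b.
Proof.
move=> bN; rewrite /verlinde_term divr_gt0 //.
  by rewrite ltr0n; case/andP: bN => _; apply: leq_ltn_trans.
by rewrite mulr_gt0 // exprn_gt0 // sin_angle_gt0.
Qed.

(** This settles genus 0, where the exponent is -1. Each inverse is 2/N - (2/N) cos(2b pi/N), and
    the N - 1 cosines add up to -1. *)
Lemma sum_invr_verlinde_term (R : realType) (N : nat) : (1 < N)%N ->
  \sum_(1 <= b < N) (verlinde_term R N b)^-1 = 2.
Proof.
move=> N1; have N0 : (0 < N)%N by apply: ltnW.
have Nn0 : (N%:R : R) != 0 by rewrite pnatr_eq0 -lt0n.
have sx : sin (1%:R * pi / N%:R) != 0 :> R by rewrite gt_eqF ?sin_angle_gt0.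
have Nx : N%:R * (1%:R * pi / N%:R) = 1%:R * pi :> R by field.
have H := cos_sum0 sx Nx.
rewrite big_ltn // mul0r mulr0 cos0 in H.
under eq_bigr => b _.
  rewrite /verlinde_term invf_div.
  have -> : 4 * sin (b%:R * pi / N%:R) ^+ 2 / N%:R =
     2 / N%:R - 2 / N%:R * cos (2 * (b%:R * (1%:R * pi / N%:R))) :> R.
    have -> : b%:R * (1%:R * pi / N%:R) = b%:R * pi / N%:R :> R by field.
    by rewrite cos_double_sin; field.
  over.
rewrite sumrB sumr_const_nat -mulr_sumr.
have -> : \sum_(1 <= b < N) cos (2 * (b%:R * (1%:R * pi / N%:R))) = -1 :> R.
  by apply/eqP; rewrite -subr_eq0 opprK addrC H.
by rewrite -[_ *+ (N - 1)]mulr_natr natrB //; field.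
Qed.

Lemma sum_even_nat (V : nmodType) (F : nat -> V) (n : nat) : (0 < n)%N ->
  \sum_(1 <= a < 2 * n | ~~ odd a) F a = \sum_(1 <= b < n) F (2 * b)%N.
Proof.
case: n => // n _; elim: n => [|n IH].
  by rewrite [RHS]big_geq // big_ltn_cond // big_geq.
have -> : (2 * n.+2 = (2 * n.+1).+2)%N by lia.
rewrite big_mkcond /= big_nat_recr /=; last by lia.
rewrite big_nat_recr /=; last by lia.
rewrite -big_mkcond /= IH [RHS]big_nat_recr //=.
have -> : odd (n + (n.+1 + 0)) = ~~ odd (2 * n.+1) by lia.
by rewrite mul2n odd_double /= addr0.
Qed.

(** Writing the even index as 2b turns the angle into b pi/q, so level 2q sees every b below q; the
    factor 2 in each term is the source of the power of 2 in (i). *)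
Lemma verlinde_double (R : realType) (q g : nat) : (0 < q)%N ->
  verlinde R (2 * q) g = \sum_(1 <= b < q) (2 * verlinde_term R q b) ^ (g%:Z - 1).
Proof.
move=> q0; rewrite /verlinde sum_even_nat //; apply: eq_bigr => b _.
have qn0 : (q%:R : R) != 0 by rewrite pnatr_eq0 -lt0n.
have -> : (2 * b)%:R * pi / (2 * q)%:R = b%:R * pi / q%:R :> R.
  by rewrite !natrM; field.
by rewrite /verlinde_term natrM; rewrite -[in LHS]mulrA.
Qed.

(** The power sum lemmas cover natural exponents only, so genus 0 has to be split off. *)
Lemma subz1E (g : nat) : g%:Z - 1 = if g is n.+1 then n%:Z else -1.
Proof. by case: g => [|n]; rewrite ?sub0r // intS; lia. Qed.

Lemma verlinde_double_nat (R : realType) (q g : nat) : (1 < q)%N ->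
  verlinde R (2 * q) g \is a @Num.nat R.
Proof.
move=> q1; have q0 : (0 < q)%N by apply: ltnW.
rewrite natrEint verlinde_double //; apply/andP; split; last first.
  rewrite big_nat sumr_ge0 // => b bq.
  by rewrite exprz_ge0 // mulr_ge0 // ltW // verlinde_term_gt0.
rewrite subz1E; case: g => [|n].
  under eq_bigr do rewrite exprN1 invfM.
  by rewrite -mulr_sumr sum_invr_verlinde_term // mulVf ?pnatr_eq0 // rpred1.
have := @power_sum_int R q 1 q0 isT (fun _ _ => dvd1n _) n.
by under eq_bigr do rewrite divr1.
Qed.

Lemma verlinde_odd_nat (R : realType) (N g : nat) : (1 < N)%N -> odd N ->
  verlinde R N g \is a @Num.nat R.
Proof.
move=> N1 oddN; have N0 : (0 < N)%N by apply: ltnW.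
rewrite natrEint; apply/andP; split; last first.
  rewrite /verlinde big_nat_cond sumr_ge0 // => b /andP[bq _].
  by rewrite exprz_ge0 // ltW // verlinde_term_gt0.
rewrite /verlinde subz1E; case: g => [|n].
  suff -> : \sum_(1 <= a < N | ~~ odd a) verlinde_term R N a ^ (-1) = 1.
    exact: rpred1.
  apply: (@mulfI _ 2); first by rewrite pnatr_eq0.
  rewrite -sum_even_half //; last by move=> b bN; rewrite verlinde_term_sym.
  by under eq_bigr do rewrite exprN1; rewrite mulr1 sum_invr_verlinde_term.
(* As N is odd, one of k and N - k is even, so [d] = 2 is allowed. *)
have d2 k : (k < N)%N -> (2 %| k * (N - k))%N.
  by move=> kN; rewrite dvdn2 oddM oddB ?(ltnW kN) // oddN; case: (odd k).
have := @power_sum_half_int R N 2 N0 isT d2 n oddN.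
under eq_bigr do rewrite mulrAC divff ?pnatr_eq0 // mul1r.
by [].
Qed.

Lemma rankVE (R : realType) (N g : nat) :
  verlinde R N g \is a @Num.nat R -> (rankV R N g)%:R = verlinde R N g.
Proof. by move=> /natrP[n Vn]; apply: (@xgetI _ 0%N [set n : nat | n%:R = verlinde R N g] n). Qed.

(** * Pairs in SL_2 and their traces *)

Section Matrix2.
Variable F : fieldType.
Implicit Types A B : 'M[F]_2.

Definition mx2 (a b c d : F) : 'M[F]_2 :=
  \matrix_(i, j) if i == 0 then (if j == 0 then a else b)
                 else (if j == 0 then c else d).

Lemma mx2_00 a b c d : mx2 a b c d 0 0 = a. Proof. by rewrite mxE. Qed.
Lemma mx2_01 a b c d : mx2 a b c d 0 1 = b. Proof. by rewrite mxE. Qed.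
Lemma mx2_10 a b c d : mx2 a b c d 1 0 = c. Proof. by rewrite mxE. Qed.
Lemma mx2_11 a b c d : mx2 a b c d 1 1 = d. Proof. by rewrite mxE. Qed.
Definition mx2E := (mx2_00, mx2_01, mx2_10, mx2_11).

Lemma ord2P (i : 'I_2) : i = 0 \/ i = 1.
Proof. by case: i => [[|[|//]] Hi]; [left | right]; apply: val_inj. Qed.

Lemma eq_mx2 A B : A 0 0 = B 0 0 -> A 0 1 = B 0 1 -> A 1 0 = B 1 0 ->
  A 1 1 = B 1 1 -> A = B.
Proof.
by move=> ? ? ? ?; apply/matrixP => i j; case: (ord2P i) => ->; case: (ord2P j) => ->.
Qed.

Lemma big_ord2 (f : 'I_2 -> F) : \sum_i f i = f 0 + f 1.
Proof.
rewrite !big_ord_recl big_ord0 addr0; congr (f _ + f _); exact: val_inj.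
Qed.

Lemma mulmx2E m n (A : 'M[F]_(m, 2)) (B : 'M[F]_(2, n)) i j :
  (A *m B) i j = A i 0 * B 0 j + A i 1 * B 1 j.
Proof. by rewrite mxE big_ord2. Qed.

Lemma mulr_mx2E A B i j : (A * B) i j = A i 0 * B 0 j + A i 1 * B 1 j.
Proof. exact: mulmx2E. Qed.

Lemma mxtrace2 A : \tr A = A 0 0 + A 1 1.
Proof. exact: big_ord2. Qed.

Lemma det2 A : \det A = A 0 0 * A 1 1 - A 0 1 * A 1 0.
Proof.
rewrite (expand_det_row _ 0) big_ord2 /cofactor !det_mx11 !mxE /=.
have -> : lift (0 : 'I_2) 0 = 1 by apply: val_inj.
have -> : lift (1 : 'I_2) 0 = 0 by apply: val_inj.
by rewrite !expr0 ?expr1 mul1r mulN1r mulrN.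
Qed.

Lemma cayley_hamilton2 A : \det A = 1 -> A * A = \tr A *: A - 1.
Proof.
rewrite det2 mxtrace2 => dA.
by apply: eq_mx2; rewrite mulr_mx2E !mxE /= -?dA; ring.
Qed.

Lemma det1_unit A : \det A = 1 -> A \is a GRing.unit.
Proof. by move=> dA; rewrite -[_ \is a _]/(A \in unitmx) unitmxE dA unitr1. Qed.

Lemma invr_mx2 A : \det A = 1 -> A^-1 = \tr A *: 1 - A.
Proof.
move=> dA; have uA := det1_unit dA; apply: (mulrI uA).
by rewrite mulrV // mulrBr cayley_hamilton2 // -scalerAr mulr1 opprB addrC subrK.
Qed.

Lemma det_mulr A B : \det (A * B) = \det A * \det B.
Proof. exact: det_mulmx. Qed.

Lemma mxtrace_mulrC A B : \tr (A * B) = \tr (B * A).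
Proof. exact: mxtrace_mulC. Qed.

Lemma mxtrace_conj P A : P \is a GRing.unit -> \tr (P * A * P^-1) = \tr A.
Proof. by move=> uP; rewrite mxtrace_mulrC mulrA mulVr // mul1r. Qed.

(** In classical notation this is U_(n-1)(X/2), with value sin(n x)/sin x at 2 cos x; the shifted
    index makes n the size of the polynomial. *)
Fixpoint chebyshevU (n : nat) : {poly F} :=
  match n with
  | 0 => 0
  | 1 => 1
  | (n'.+1 as m).+1 => 'X * chebyshevU m - chebyshevU n'
  end.

Lemma chebyshevUSS n :
  chebyshevU n.+2 = 'X * chebyshevU n.+1 - chebyshevU n.
Proof. by []. Qed.

Lemma size_chebyshevU n : size (chebyshevU n) = n.
Proof.
suff [] : size (chebyshevU n) = n /\ size (chebyshevU n.+1) = n.+1 by [].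
elim: n => [|n [IH1 IH2]]; first by rewrite /= size_poly0 size_poly1.
split=> //; rewrite chebyshevUSS.
have U0 : chebyshevU n.+1 != 0 by rewrite -size_poly_eq0 IH2.
rewrite size_polyDl mulrC size_mulX // IH2 //.
by rewrite size_polyN IH1.
Qed.

(** By Cayley-Hamilton, A^2 = tr(A) A - 1, so the coefficients of the powers of A obey the Chebyshev
    recurrence. *)
Lemma mx2_expr A n : \det A = 1 ->
  A ^+ n.+1 = (chebyshevU n.+1).[\tr A] *: A - (chebyshevU n).[\tr A] *: 1.
Proof.
move=> dA; elim: n => [|n IH].
  by rewrite /= !hornerE scale1r scale0r subr0.
rewrite exprS IH chebyshevUSS !hornerE mulrBr -!scalerAr cayley_hamilton2 // mulr1.
by apply/matrixP => i j; rewrite !mxE; ring.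
Qed.

End Matrix2.

(** * Irreducible pairs and their normal form *)

Section CommonEigenvector.
Variable R : realType.
Notation C := R[i].
Implicit Types (A B P : 'M[C]_2) (rho sigma : 'M[C]_2 * 'M[C]_2).

(** A proper nonzero subspace of C^2 is a line, and an invariant line is spanned by a common
    eigenvector. Transposition passes between row spaces and column vectors. *)
Lemma irreducible_pairP rho : irreducible_pair rho <->
  (forall (v : 'cV[C]_2) k l, v != 0 -> rho.1 *m v = k *: v ->
     rho.2 *m v = l *: v -> False).
Proof.
split=> [irr v k l v0 Av Bv | noev U sA sB].
  have stab M (x : C) : M *m v = x *: v -> stablemx <<v^T>>%MS M^T.
    move=> Mv; rewrite (eqmxMr _ (genmxE _)) genmxE -trmx_mul Mv.
    by rewrite linearZ /= scalemx_sub.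
  have rU : \rank <<v^T>>%MS = 1%N.
    by rewrite genmxE rank_rV trmx_eq0 v0.
  have [U0|] := irr _ (stab _ _ Av) (stab _ _ Bv).
    by move: rU; rewrite U0 mxrank0.
  by rewrite /row_full rU.
have [->|U0] := eqVneq U 0; first by left.
right; case: (boolP (row_full U)) => // nfull; exfalso.
have rU : \rank U = 1%N.
  have := rank_leq_col U; rewrite -mxrank_eq0 in U0.
  by move: nfull U0; rewrite /row_full; lia.
have v0 : nz_row U != 0 by rewrite nz_row_eq0.
have Uv : (U <= nz_row U)%MS.
  by rewrite -(mxrank_leqif_sup (nz_row_sub U)) rU rank_rV v0.
have stab M : stablemx U M^T -> exists k, M *m (nz_row U)^T = k *: (nz_row U)^T.
  move=> sM.
  have /sub_rVP[k Hk] : (nz_row U *m M^T <= nz_row U)%MS.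
    exact: submx_trans (submxMr _ (nz_row_sub U)) (submx_trans sM Uv).
  by exists k; rewrite -[M in LHS]trmxK -trmx_mul Hk linearZ.
have [k Ak] := stab _ sA; have [l Bl] := stab _ sB.
by apply: (noev _ _ _ _ Ak Bl); rewrite trmx_eq0.
Qed.

Lemma irreducible_not_comm A B : irreducible_pair (A, B) -> A * B <> B * A.
Proof.
move=> /irreducible_pairP noev AB.
have [|v v0 /andP[/sub_rVP[k Ak] /sub_rVP[l Bl]]] := @common_eigenvector2 _ 2 A^T B^T isT.
  by rewrite -!trmx_mul; congr trmx.
apply: (noev v^T k l); rewrite ?trmx_eq0 //.
  by rewrite -[A in LHS]trmxK -trmx_mul Ak linearZ.
by rewrite -[B in LHS]trmxK -trmx_mul Bl linearZ.
Qed.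

Lemma conj_class_refl rho : conj_class rho rho.
Proof. by exists 1; rewrite ?det1 // invr1 !mul1r !mulr1 -surjective_pairing. Qed.

Lemma conj_class_eq rho sigma : conj_class rho sigma ->
  conj_class sigma = conj_class rho.
Proof.
move=> [P dP ->]; have uP := det1_unit dP.
apply/seteqP; split=> _ [Q dQ ->] /=.
  exists (Q * P); first by rewrite det_mulr dQ dP mulr1.
  by rewrite invrM ?det1_unit // !mulrA.
exists (Q * P^-1).
  have := det_mulr P P^-1; rewrite mulrV // det1 dP mul1r => dPV.
  by rewrite det_mulr dQ -dPV mul1r.
rewrite invrM ?unitrV ?det1_unit // invrK.
by congr (_, _); rewrite !mulrA; congr (_ * _);
   rewrite -!mulrA mulVr ?det1_unit // mulr1 (mulrA P^-1) mulVr // mul1r.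
Qed.

Lemma conj_class_traces rho sigma : conj_class rho = conj_class sigma ->
  \tr rho.1 = \tr sigma.1 /\ \tr rho.2 = \tr sigma.2.
Proof.
move=> E; have := conj_class_refl sigma; rewrite -E => -[P dP ->] /=.
by rewrite !mxtrace_conj ?det1_unit.
Qed.

Lemma conj_mulr P A B : P \is a GRing.unit ->
  P * A * P^-1 * (P * B * P^-1) = P * (A * B) * P^-1.
Proof. by move=> uP; rewrite !mulrA mulrVK. Qed.

(** These are A and B in the basis (v, Bv), where Av = lam v: A is triangular and B is the companion
    matrix of X^2 - t X + 1. The corner entry of A is chosen so that tr AB = z. *)
Definition normal_form (lam z t : C) : 'M[C]_2 * 'M[C]_2 :=
  (mx2 lam (z - lam^-1 * t) 0 lam^-1, mx2 0 (-1) 1 t).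

Lemma conj_normal_form A B (lam : C) : \det A = 1 -> \det B = 1 ->
  irreducible_pair (A, B) -> lam != 0 -> \tr A = lam + lam^-1 ->
  conj_class (normal_form lam (\tr (A * B)) (\tr B)) (A, B).
Proof.
move=> dA dB /irreducible_pairP /= noev lam0 tA.
have [v v0 Av] : exists2 v : 'cV[C]_2, v != 0 & A *m v = lam *: v.
  (* The trace and determinant of A make [lam] an eigenvalue; the transpose appears because [det0P]
     yields row vectors. *)
  have : \det (A - lam%:M)^T == 0.
    rewrite det_tr det2 !mxE /=.
    move: tA; rewrite mxtrace2 => tA.
    have -> : A 1 1 = lam + lam^-1 - A 0 0 by rewrite -tA addrAC subrr add0r.
    move: dA; rewrite det2.
    have -> : A 1 1 = lam + lam^-1 - A 0 0 by rewrite -tA addrAC subrr add0r.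
    move=> dA; apply/eqP; rewrite mulr1n !mulr0n !subr0.
    have -> : A 0 1 * A 1 0 = A 0 0 * (lam + lam^-1 - A 0 0) - 1 by rewrite -dA; ring.
    by field.
  move=> /det0P[u u0 uA]; exists u^T; rewrite ?trmx_eq0 //.
  move/(congr1 trmx): uA; rewrite trmx_mul trmxK trmx0 mulmxBl mul_scalar_mx.
  by move/eqP; rewrite subr_eq0 => /eqP.
have [w wdef] : {w | w = B *m v} by exists (B *m v).
have Bw : B *m w = \tr B *: w - v.
  by rewrite wdef mulmxA mulmxE cayley_hamilton2 // mulmxBl mul1mx -scalemxAl.
(* This is the determinant of the basis (v, Bv). If it vanished, v would be an eigenvector of B too,
   against irreducibility. *)
pose d := v 0 0 * w 1 0 - w 0 0 * v 1 0.
have d0 : d != 0.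
  apply/eqP => d0; have [v00|v00] := eqVneq (v 0 0) 0.
    have v10 : v 1 0 != 0.
      apply: contra v0 => /eqP v10; apply/eqP/matrixP => i j.
      by rewrite ord1 mxE; case: (ord2P i) => ->.
    apply: (noev v lam (w 1 0 / v 1 0) v0 Av).
    apply/matrixP => i j; rewrite ord1 [RHS]mxE -wdef.
    case: (ord2P i) => ->; last by rewrite divfK.
    move/eqP: d0; rewrite /d v00 mul0r sub0r oppr_eq0 mulf_eq0 (negPf v10) orbF.
    by move/eqP ->; rewrite mulr0.
  apply: (noev v lam (w 0 0 / v 0 0) v0 Av).
  apply/matrixP => i j; rewrite ord1 [RHS]mxE -wdef.
  case: (ord2P i) => ->; first by rewrite divfK.
  by apply: (mulfI v00); move/eqP: d0; rewrite subr_eq0 => /eqP ->; field.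
(* Scaling both basis vectors by d^(-1/2) gives a base change of determinant 1, as [conj_class]
   demands, without altering the matrices. *)
pose e := (sqrtC d)^-1.
have ee : e * e * d = 1.
  rewrite /e -invfM -expr2 sqrtCK mulVf //.
pose P := mx2 (e * v 0 0) (e * w 0 0) (e * v 1 0) (e * w 1 0).
have dP : \det P = 1 by rewrite det2 !mx2E -ee /d; ring.
have uP := det1_unit dP.
have vE := mulmx2E A v; have wE := mulmx2E B v; have bE := mulmx2E B w.
have BP : B * P = P * mx2 0 (-1) 1 (\tr B).
  rewrite -wdef in wE; rewrite Bw in bE.
  have := bE 1 0; have := bE 0 0; rewrite !mxE => b0 b1.
  apply: eq_mx2; rewrite !mulr_mx2E !mx2E.
  - by rewrite (wE 0 0); ring.
  - transitivity (e * (B 0 0 * w 0 0 + B 0 1 * w 1 0)); first by ring.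
    by rewrite -b0; ring.
  - by rewrite (wE 1 0); ring.
  - transitivity (e * (B 1 0 * w 0 0 + B 1 1 * w 1 0)); first by ring.
    by rewrite -b1; ring.
have [A1 A1def] : {A1 | A1 = P^-1 * A * P} by exists (P^-1 * A * P).
have AE : A = P * A1 * P^-1.
  by rewrite A1def !mulrA mulrV // mul1r -mulrA mulrV // mulr1.
have BE : B = P * mx2 0 (-1) 1 (\tr B) * P^-1.
  by rewrite -BP -mulrA mulrV // mulr1.
(* The first column comes from Av = lam v; the other two entries then follow from tr A and tr AB. *)
have A1col i : A1 i 0 = lam * (1 : 'M[C]_2) i 0.
  rewrite A1def -mulrA -(mulVr uP) !mulr_mx2E !mx2E.
  rewrite Av in vE.
  have := vE 0 0; have := vE 1 0; rewrite !mxE => H1 H0.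
  transitivity (P^-1 i 0 * (e * (A 0 0 * v 0 0 + A 0 1 * v 1 0)) +
                P^-1 i 1 * (e * (A 1 0 * v 0 0 + A 1 1 * v 1 0))); first by ring.
  by rewrite -H0 -H1; ring.
have A00 : A1 0 0 = lam by rewrite A1col mxE mulr1.
have A10 : A1 1 0 = 0 by rewrite A1col mxE mulr0.
have A11 : A1 1 1 = lam^-1.
  have : \tr A1 = lam + lam^-1 by rewrite -tA AE mxtrace_conj.
  by rewrite mxtrace2 A00 => /addrI.
have A01 : A1 0 1 = \tr (A * B) - lam^-1 * \tr B.
  have -> : \tr (A * B) = \tr (A1 * mx2 0 (-1) 1 (\tr B)).
    by rewrite {1}AE {1}BE conj_mulr // mxtrace_conj.
  by rewrite mxtrace2 !mulr_mx2E !mx2E A11 A10; ring.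
have A1E : A1 = mx2 lam (\tr (A * B) - lam^-1 * \tr B) 0 lam^-1.
  by apply: eq_mx2; rewrite !mx2E.
exists P; first exact: dP.
by rewrite /normal_form /= -A1E -AE -BE.
Qed.

End CommonEigenvector.

(** * Traces of irreducible representations *)

Section TraceCoordinates.
Variable R : realType.
Notation C := R[i].
Implicit Types (A B : 'M[C]_2).

Lemma normal_form_det (lam z t : C) : lam != 0 ->
  \det (normal_form lam z t).1 = 1 /\ \det (normal_form lam z t).2 = 1.
Proof.
move=> lam0; rewrite !det2 /normal_form /= !mx2E; split; last by ring.
by rewrite mulfV // mulr0 subr0.
Qed.

Lemma normal_form_traces (lam z t : C) :
  [/\ \tr (normal_form lam z t).1 = lam + lam^-1,
      \tr (normal_form lam z t).2 = t &
      \tr ((normal_form lam z t).1 * (normal_form lam z t).2) = z].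
Proof.
rewrite /normal_form /= !mxtrace2 !mulr_mx2E !mx2E; split=> //; first by ring.
by ring.
Qed.

(** A common eigenvector has nonzero coordinates, so the triangular matrix acts on it by [lam^-1],
    and the eigenvalue l of the other matrix is [mu] or [mu^-1]. Each choice of l forces z to be one
    of the two excluded values. *)
Lemma normal_form_irreducible (lam mu z : C) : lam != 0 -> mu != 0 ->
  z != lam * mu + (lam * mu)^-1 -> z != lam / mu + (lam / mu)^-1 ->
  irreducible_pair (normal_form lam z (mu + mu^-1)).
Proof.
move=> lam0 mu0 z1 z2; apply/irreducible_pairP => v k l v0 /=.
set t := mu + mu^-1 => Av Bv.
have := mulmx2E (mx2 lam (z - lam^-1 * t) 0 lam^-1) v.
have := mulmx2E (mx2 0 (-1) 1 t) v.
rewrite Av Bv => HB HA.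
have := HB 0 0; have := HB 1 0; have := HA 0 0; have := HA 1 0.
have scE (x : C) i : (x *: v) i 0 = x * v i 0 by rewrite mxE.
rewrite !mx2E !scE.
rewrite !mul0r !add0r mulN1r mul1r => a1 a0 b1 b0.
have v10 : v 1 0 = - l * v 0 0 by rewrite mulNr b0 opprK.
have v00 : v 0 0 != 0.
  apply: contra v0 => /eqP v00; apply/eqP/matrixP => i j.
  by rewrite ord1 mxE; case: (ord2P i) => -> //; rewrite v10 v00 mulr0.
have chi : (l - mu) * (l - mu^-1) = 0.
  apply: (mulfI v00); rewrite mulr0.
  transitivity (v 0 0 + t * (- l * v 0 0) - l * (- l * v 0 0)).
    by rewrite /t; field.
  by rewrite -v10 b1 subrr.
have l0 : l != 0.
  apply/eqP => l0; move/eqP: chi; rewrite l0 !sub0r mulrNN mulfV //.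
  by rewrite oner_eq0.
have kE : k = lam^-1.
  apply: (@mulIf _ (v 1 0)); last exact: a1.
  by rewrite v10 mulf_neq0 // oppr_eq0.
have zE : z = lam^-1 * t + (lam - lam^-1) / l.
  apply: (mulfI v00); apply: (mulfI l0).
  move: a0; rewrite kE v10 => a0.
  transitivity (lam * v 0 0 - lam^-1 * v 0 0 + v 0 0 * l * (lam^-1 * t)); last first.
    by field; rewrite l0 lam0.
  by rewrite a0; ring.
move/eqP: chi; rewrite mulf_eq0 !subr_eq0 => /orP[] /eqP lE.
  move/eqP: z2; apply; rewrite zE lE /t.
  by field; rewrite ?lam0 ?mu0.
move/eqP: z1; apply; rewrite zE lE /t.
by field; rewrite ?lam0 ?mu0.
Qed.

Definition cis (x : R) : C := (cos x +i* sin x)%C.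

Lemma cisD x y : cis (x + y) = cis x * cis y.
Proof.
apply/eqP; rewrite eq_complex /= cosD sinD; apply/andP; split; apply/eqP; ring.
Qed.

Lemma cis0 : cis 0 = 1.
Proof. by rewrite /cis cos0 sin0. Qed.

Lemma cis_mulN x : cis x * cis (- x) = 1.
Proof. by rewrite -cisD subrr cis0. Qed.

Lemma cis_neq0 x : cis x != 0.
Proof.
by apply/eqP => x0; have := cis_mulN x; rewrite x0 mul0r => /esym/eqP; rewrite oner_eq0.
Qed.

Lemma cisV x : (cis x)^-1 = cis (- x).
Proof. by apply: (mulfI (cis_neq0 x)); rewrite cis_mulN mulfV ?cis_neq0. Qed.

Lemma cis_add_inv x : cis x + (cis x)^-1 = (2 * cos x)%:C.
Proof.
rewrite cisV /cis cosN sinN; apply/eqP; rewrite eq_complex /=.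
by apply/andP; split; apply/eqP; ring.
Qed.

Lemma normal_form_cis_irreducible (x y : R) (z : C) :
  z <> (2 * cos (x + y))%:C -> z <> (2 * cos (x - y))%:C ->
  irreducible_pair (normal_form (cis x) z (2 * cos y)%:C).
Proof.
move=> /eqP z1 /eqP z2; rewrite -cis_add_inv.
apply: normal_form_irreducible; rewrite ?cis_neq0 //.
  by rewrite -cisD cis_add_inv.
by rewrite (cisV y) -cisD cis_add_inv.
Qed.

(** Both sides satisfy the same recurrence, as sin((n+2)x) + sin(n x) = 2 cos x sin((n+1)x). It has
    two steps, hence the induction on a pair. *)
Lemma chebyshevU_cos (x : R) n :
  (chebyshevU C n).[(2 * cos x)%:C] * (sin x)%:C = (sin (n%:R * x))%:C.
Proof.
suff [] : (chebyshevU C n).[(2 * cos x)%:C] * (sin x)%:C = (sin (n%:R * x))%:C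
  /\ (chebyshevU C n.+1).[(2 * cos x)%:C] * (sin x)%:C = (sin (n.+1%:R * x))%:C by [].
elim: n => [|n [IH0 IH1]].
  by rewrite /= !hornerE sin0.
split=> //; rewrite chebyshevUSS !hornerE mulrBl -mulrA IH0 IH1 -rmorphM -rmorphB.
congr (_%:C).
have -> : n.+2%:R * x = n.+1%:R * x + x by rewrite -[n.+2%:R]natr1; ring.
have -> : n%:R * x = n.+1%:R * x - x by rewrite -[n.+1%:R]natr1; ring.
by rewrite sinB sinD; ring.
Qed.

Lemma sin_pi_frac_gt0 (p a : nat) : (0 < a < p)%N -> 0 < sin (pi * a%:R / p%:R) :> R.
Proof. by move=> ap; rewrite [pi * _]mulrC sin_angle_gt0. Qed.

Lemma cos_pi_frac_inj (p a b : nat) : (0 < a < p)%N -> (0 < b < p)%N ->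
  cos (pi * a%:R / p%:R) = cos (pi * b%:R / p%:R) :> R -> a = b.
Proof.
move=> ap bp /cos_inj.
have p0 : (0 : R) < p%:R by rewrite ltr0n; case/andP: ap => _; apply: leq_ltn_trans.
have pi0 := pi_gt0 R.
have dom c : (0 < c < p)%N -> pi * c%:R / p%:R \in `[0, (pi : R)].
  move=> /andP[_ cp]; rewrite in_itv /=; apply/andP; split.
    by rewrite divr_ge0 ?mulr_ge0 ?pi_ge0.
  by rewrite ler_pdivrMr // ler_pM2l // ler_nat ltnW.
move=> /(_ (dom _ ap) (dom _ bp)) /(mulIf (invr_neq0 (lt0r_neq0 p0))).
by move=> /(mulfI (lt0r_neq0 pi0)) /eqP; rewrite eqr_nat => /eqP.
Qed.

(** The p - 1 distinct numbers 2 cos(pi a/p) are roots of a polynomial of degree p - 1, which leaves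
    no room for a further root. *)
Lemma chebyshevU_root (p : nat) (t : C) : (0 < p)%N ->
  (chebyshevU C p).[t] = 0 ->
  exists2 a, (0 < a < p)%N & t = (2 * cos (pi * a%:R / p%:R))%:C.
Proof.
move=> p0 Ut.
pose f a : C := (2 * cos (pi * a%:R / p%:R))%:C.
pose rs := [seq f a | a <- iota 1 p.-1].
have iotaP a : a \in iota 1 p.-1 -> (0 < a < p)%N.
  by rewrite mem_iota => /andP[a0 ap]; rewrite a0 /=; lia.
have f_inj : {in iota 1 p.-1 &, injective f}.
  move=> a b /iotaP ap /iotaP bp /complexI /(mulfI (_ : 2 != 0)).
  by rewrite pnatr_eq0 => /(_ isT); apply: cos_pi_frac_inj.
have root_rs : all (root (chebyshevU C p)) rs.
  apply/allP => _ /mapP[a /iotaP ap ->]; apply/rootP.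
  apply: (@mulIf _ (sin (pi * a%:R / p%:R))%:C).
    by rewrite (inj_eq (@complexI R)) gt_eqF ?sin_pi_frac_gt0.
  rewrite chebyshevU_cos mul0r.
  have -> : p%:R * (pi * a%:R / p%:R) = a%:R * pi :> R.
    by field; rewrite pnatr_eq0 -lt0n.
  by rewrite sin_natpi.
have U0 : chebyshevU C p != 0 by rewrite -size_poly_eq0 size_chebyshevU -lt0n.
have [/mapP[a ain ->]|tn] := boolP (t \in rs); first by exists a; first exact: iotaP.
have := @max_poly_roots _ _ (t :: rs) U0.
rewrite /= root_rs andbT tn map_inj_in_uniq // iota_uniq size_map size_iota.
rewrite size_chebyshevU prednK // ltnn.
by move=> /(_ (introT rootP Ut) isT).
Qed.

(** The meridian x^-r y^s calls for integer exponents. The inverse tr(A) - A has the same trace and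
    determinant as A, so negative powers reduce to natural ones by the addition formula for the
    sine. *)
Lemma mx2_exprz A (x : R) (k : int) : \det A = 1 -> \tr A = (2 * cos x)%:C ->
  sin x != 0 ->
  A ^ k = (sin (k%:~R * x) / sin x)%:C *: A - (sin ((k%:~R - 1) * x) / sin x)%:C *: 1.
Proof.
move=> dA tA sx.
have sxC : (sin x)%:C != 0 :> C by rewrite (inj_eq (@complexI R)).
have UE n : (chebyshevU C n).[\tr A] = (sin (n%:R * x) / sin x)%:C.
  apply: (mulIf sxC); rewrite tA chebyshevU_cos -rmorphM.
  by congr (_%:C); rewrite divfK.
have pow n : A ^+ n = (sin (n%:R * x) / sin x)%:C *: A
                     - (sin ((n%:R - 1) * x) / sin x)%:C *: 1.
  case: n => [|n].
    rewrite expr0 mul0r sin0 mul0r scale0r !sub0r mulN1r sinN mulNr divff //.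
    by rewrite rmorphN rmorph1 scaleN1r opprK.
  by rewrite (mx2_expr _ dA) (UE n.+1) (UE n) -[n.+1%:R]natr1 addrK.
case: k => n; first by rewrite -exprnP pow.
have uA := det1_unit dA.
rewrite NegzE -exprnN -exprVn.
have tV : \tr A^-1 = \tr A.
  by rewrite invr_mx2 // linearB linearZ /= mxtrace1; ring.
have dV : \det A^-1 = 1.
  by have := det_mulr A A^-1; rewrite mulrV // det1 dA mul1r => <-.
rewrite (mx2_expr _ dV) tV (UE n.+1) (UE n) (invr_mx2 dA) tA.
have scal_id (u w t : C) :
    u *: (t *: 1 - A) - w *: 1 = - u *: A - (w - u * t) *: 1.
  by apply/matrixP => i j; rewrite !mxE; ring.
rewrite scal_id.
have -> : (- n.+1%:Z)%:~R * x = - (n.+1%:R * x) by rewrite mulrNz mulNr.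
have -> : ((- n.+1%:Z)%:~R - 1) * x = - (n.+1%:R * x + x).
  by rewrite mulrNz; ring.
have -> : n%:R * x = n.+1%:R * x - x by rewrite -[n.+1%:R]natr1; ring.
rewrite -rmorphM -rmorphB !sinN !mulNr rmorphN.
set y := n.+1%:R * x.
suff -> : sin (y - x) / sin x - sin y / sin x * (2 * cos x) =
          - (sin (y + x) / sin x) by [].
by rewrite sinB sinD; ring.
Qed.

Lemma mx2_expr_torsion A (p a : nat) : (0 < a < p)%N -> \det A = 1 ->
  \tr A = (2 * cos (pi * a%:R / p%:R))%:C -> A ^+ p = ((-1) ^+ a)%:C *: 1.
Proof.
move=> ap dA tA; have sx := sin_pi_frac_gt0 ap.
have p0 : (p%:R : R) != 0 by rewrite pnatr_eq0; lia.
rewrite exprnP (mx2_exprz _ dA tA) ?gt_eqF //.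
have -> : (p : int)%:~R * (pi * a%:R / p%:R) = a%:R * pi :> R by field.
have -> : ((p : int)%:~R - 1) * (pi * a%:R / p%:R) =
  a%:R * pi - (pi * a%:R / p%:R) :> R by field.
rewrite sinB sin_natpi cos_natpi !mul0r scale0r !sub0r mulNr mulfK ?gt_eqF //.
by rewrite rmorphN scaleNr opprK.
Qed.

(** The element A^p = B^q commutes with A and B. If the Chebyshev coefficient of A in A^p were
    nonzero, A itself would commute with B, contradicting irreducibility. So both traces are of
    cosine form. *)
Lemma irr_rep_component (p q : nat) (rho : 'M[C]_2 * 'M[C]_2) :
  (0 < p)%N -> (0 < q)%N -> irr_reps p q rho ->
  exists2 ab, component_index p q ab &
    \tr rho.1 = (2 * cos (pi * ab.1%:R / p%:R))%:C /\
    \tr rho.2 = (2 * cos (pi * ab.2%:R / q%:R))%:C.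
Proof.
case: rho => A B p0 q0 [[/= dA dB AB] irr].
have nc := irreducible_not_comm irr.
have scal (M N : 'M[C]_2) n : \det M = 1 -> (0 < n)%N -> M * N <> N * M ->
    M ^+ n * N = N * M ^+ n -> (chebyshevU C n).[\tr M] = 0.
  case: n => // n dM _ ncMN; rewrite (mx2_expr n dM) => E.
  apply/eqP; apply: contra_notT ncMN => u0.
  apply: (scalerI u0); move: E.
  rewrite mulrBl mulrBr -!scalerAl -!scalerAr mulr1 mul1r.
  by move=> /addIr.
have [a ap tA] : exists2 a, (0 < a < p)%N & \tr A = (2 * cos (pi * a%:R / p%:R))%:C.
  apply: chebyshevU_root => //; apply: (scal A B) => //.
  by rewrite AB -exprSr exprS.
have [b bq tB] : exists2 b, (0 < b < q)%N & \tr B = (2 * cos (pi * b%:R / q%:R))%:C.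
  apply: chebyshevU_root => //; apply: (scal B A) => //; first by move/esym.
  by rewrite -AB -exprSr exprS.
exists (a, b) => //; split=> //=.
(* Now A^p = (-1)^a and B^q = (-1)^b, which forces a and b to have the same parity. *)
have := AB; rewrite (mx2_expr_torsion ap dA tA) (mx2_expr_torsion bq dB tB).
move=> /matrixP /(_ 0 0); rewrite !mxE /= !mulr1 => /complexI.
rewrite -signr_odd -[RHS]signr_odd !modn2.
by case: (odd a); case: (odd b) => //= H; exfalso; move: H; rewrite expr1 expr0; lra.
Qed.

(** Both powers are affine in A and B, so the trace is affine in tr AB. It is expanded around tr AB
    = 2 cos(x + y), the value for simultaneously diagonal matrices, where the answer is 2 cos(k x +
    l y). *)
Lemma mxtrace_exprz_mul A B (x y : R) (k l : int) :
  \det A = 1 -> \det B = 1 -> \tr A = (2 * cos x)%:C -> \tr B = (2 * cos y)%:C ->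
  sin x != 0 -> sin y != 0 ->
  \tr (A ^ k * B ^ l) =
    (2 * cos (k%:~R * x + l%:~R * y))%:C +
    (sin (k%:~R * x) / sin x * (sin (l%:~R * y) / sin y))%:C *
      (\tr (A * B) - (2 * cos (x + y))%:C).
Proof.
move=> dA dB tA tB sx sy.
rewrite (mx2_exprz k dA tA sx) (mx2_exprz l dB tB sy).
rewrite mulrBl !mulrBr -!scalerAl -!scalerAr !mulr1 mul1r !scalerA.
rewrite !linearB /= !mxtraceZ ?mxtrace1 tA tB.
set z := \tr _.
have -> : (k%:~R - 1) * x = k%:~R * x - x by ring.
have -> : (l%:~R - 1) * y = l%:~R * y - y by ring.
rewrite !sinB !cosD.
set sk := sin (k%:~R * x); set ck := cos (k%:~R * x).
set sl := sin (l%:~R * y); set cl := cos (l%:~R * y).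
apply/eqP; rewrite -subr_eq0; apply/eqP.
(* The terms in z cancel; what remains is a real identity, to be checked over R. *)
transitivity ((sk / sin x * (sl / sin y) * (2 * (cos x * cos y - sin x * sin y)) -
  sk / sin x * (2 * cos x) * ((sl * cos y - cl * sin y) / sin y) -
  (sk * cos x - ck * sin x) / sin x * (sl / sin y * (2 * cos y)) +
  2 * (sk * cos x - ck * sin x) / sin x * ((sl * cos y - cl * sin y) / sin y) -
  2 * (ck * cl - sk * sl))%:C : C).
  rewrite !(rmorphB, rmorphM, rmorphD) /=; ring.
rewrite -[RHS](rmorph0 (real_complex R)); congr (_%:C).
by field; rewrite sx sy.
Qed.

End TraceCoordinates.

(** * Summation over the classes *)

Section TorsionSum.
Variable R : realType.

(** This will be the sum of the m-th powers of the torsions with the sign [eps] removed. *)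
Definition torsion_sum (p q : nat) (m : int) : R :=
  \sum_(1 <= a < p) \sum_(1 <= b < q | odd a == odd b)
    (verlinde_term R p a * verlinde_term R q b) ^ m.

Lemma torsion_sumC p q m : torsion_sum p q m = torsion_sum q p m.
Proof.
rewrite /torsion_sum; under eq_bigr do rewrite big_mkcond /=.
rewrite exchange_big /=; apply: eq_bigr => b _; rewrite -big_mkcond /=.
by apply: eq_big => [a|a _]; rewrite 1?eq_sym // mulrC.
Qed.

(** For fixed b, the index a runs over one parity class. Since a |-> p - a exchanges the two
    classes, the inner sum does not depend on b and factors out. *)
Lemma torsion_sum_odd p q (m : int) : odd p ->
  torsion_sum p q m =
    (\sum_(1 <= a < p | ~~ odd a) verlinde_term R p a ^ m) *
    (\sum_(1 <= b < q) verlinde_term R q b ^ m).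
Proof.
move=> oddp; set Ve := \sum_(_ <= _ < _ | _) _.
have sym a : (0 < a < p)%N -> verlinde_term R p (p - a) ^ m = verlinde_term R p a ^ m.
  by move=> ap; rewrite verlinde_term_sym.
have Vodd : \sum_(1 <= a < p | odd a) verlinde_term R p a ^ m = Ve.
  have := sum_even_half oddp sym; rewrite (bigID odd) /= -/Ve.
  by rewrite mulr_natl mulr2n => /addIr.
rewrite torsion_sumC /torsion_sum mulr_sumr; apply: eq_bigr => b _.
under eq_bigr do rewrite mulrC expfzMl.
rewrite -mulr_suml; congr (_ * _).
by case: (odd b) => //; apply: eq_bigl => a; case: (odd a).
Qed.

(** Level 2q doubles every term of the sum over b, and 2^(-m) compensates. As m >= -1,
    [absz (m + 1)] is the genus m + 1. *)
Lemma torsion_sum_verlinde p q (m : int) : odd p -> (0 < q)%N -> -1 <= m ->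
  torsion_sum p q m =
    2 ^ (- m) * verlinde R p (absz (m + 1)) * verlinde R (2 * q) (absz (m + 1)).
Proof.
move=> oddp q0 hm; rewrite torsion_sum_odd // verlinde_double // /verlinde.
have -> : (absz (m + 1))%:Z - 1 = m by lia.
have -> : \sum_(1 <= b < q) (2 * verlinde_term R q b) ^ m =
          2 ^ m * \sum_(1 <= b < q) verlinde_term R q b ^ m.
  by rewrite mulr_sumr; apply: eq_bigr => b _; rewrite expfzMl.
rewrite mulrACA -expfzDr ?pnatr_eq0 //.
by rewrite addNr expr0z mul1r.
Qed.

Lemma torsion_sum_verlinde_odd p q (m : int) : odd p -> odd q -> -1 <= m ->
  torsion_sum p q m =
    2 * verlinde R p (absz (m + 1)) * verlinde R q (absz (m + 1)).
Proof.
move=> oddp oddq hm; rewrite torsion_sum_odd // /verlinde.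
have -> : (absz (m + 1))%:Z - 1 = m by lia.
rewrite (sum_even_half oddq); first by rewrite mulrCA mulrA.
by move=> b bq; rewrite verlinde_term_sym.
Qed.

End TorsionSum.

(** * Irreducible classes with prescribed meridian trace *)

Section Classes.
Variable R : realType.
Notation C := R[i].

Lemma sin_intpi (k : int) : sin (k%:~R * pi) = 0 :> R.
Proof.
case: k => n; first exact: sin_natpi.
by rewrite NegzE mulrNz mulNr sinN sin_natpi oppr0.
Qed.

Lemma sin_mulz_eq0 (x : R) (k : int) : sin x = 0 -> sin (k%:~R * x) = 0.
Proof.
move=> sx; case: k => n; first exact: sin_mul_eq0.
by rewrite NegzE mulrNz mulNr sinN sin_mul_eq0 ?oppr0.
Qed.

(** If the sine vanished, so would the sine of u times the angle. By the Bezout relation that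
    multiple is pi a/p - v a pi, whose sine is nonzero. This gives the nonvanishing of [slope]. *)
Lemma sin_bezout_neq0 (p a : nat) (r u v : int) : (0 < a < p)%N ->
  r * u + p%:Z * v = 1 -> sin (r%:~R * (pi * a%:R / p%:R)) != 0 :> R.
Proof.
move=> ap bez; apply/eqP => /(sin_mulz_eq0 u).
have p0 : (p%:R : R) != 0 by rewrite pnatr_eq0; lia.
have bezR : r%:~R * u%:~R = 1 - p%:R * v%:~R :> R.
  have := congr1 (fun k : int => k%:~R : R) bez.
  by rewrite intrD !intrM -pmulrn mulr1z => H; apply/eqP; rewrite eq_sym subr_eq H.
have -> : u%:~R * (r%:~R * (pi * a%:R / p%:R)) =
          pi * a%:R / p%:R - (v * a%:Z)%:~R * pi :> R.
  by rewrite mulrA [u%:~R * _]mulrC bezR intrM; field.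
rewrite sinB sin_intpi mulr0 subr0 => /eqP.
rewrite mulf_eq0 gt_eqF ?sin_pi_frac_gt0 //= => /eqP cv.
have := cos2Dsin2 ((v * a%:Z)%:~R * pi : R).
by rewrite cv sin_intpi expr0n addr0 => /esym/eqP; rewrite oner_eq0.
Qed.

Variables (p q : nat) (r s : int) (c : C).
Hypotheses (p0 : (0 < p)%N) (q0 : (0 < q)%N).
Hypothesis hrs : p%:Z * s - q%:Z * r = 1.
Hypothesis hc : forall a b : nat, component_index p q (a, b) ->
  c <> (2 * cos (pi * (r%:~R * a%:R / p%:R + s%:~R * b%:R / q%:R)))%:C /\
  c <> (2 * cos (pi * (r%:~R * a%:R / p%:R - s%:~R * b%:R / q%:R)))%:C.

Let th (a : nat) : R := pi * a%:R / p%:R.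
Let ph (b : nat) : R := pi * b%:R / q%:R.

(** The coefficient of tr rho(xy) in tr rho(mu), from [mxtrace_exprz_mul] with exponents -r and s.
    Next, [trace_xy] solves tr rho(mu) = c for tr rho(xy). *)
Let slope (ab : nat * nat) : R :=
  sin ((- r)%:~R * th ab.1) / sin (th ab.1) *
  (sin (s%:~R * ph ab.2) / sin (ph ab.2)).

Let trace_xy (ab : nat * nat) : C :=
  (2 * cos (th ab.1 + ph ab.2))%:C +
  (c - (2 * cos ((- r)%:~R * th ab.1 + s%:~R * ph ab.2))%:C) / (slope ab)%:C.

Let rep (ab : nat * nat) : 'M[C]_2 * 'M[C]_2 :=
  normal_form (cis (th ab.1)) (trace_xy ab) (2 * cos (ph ab.2))%:C.

Let slope_neq0 ab : component_index p q ab -> (slope ab)%:C != 0.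
Proof.
case: ab => a b [/= ap bq _]; rewrite (inj_eq (@complexI R)).
have bez1 : - r * q%:Z + p%:Z * s = 1 by lia.
have bez2 : s * p%:Z + q%:Z * - r = 1 by lia.
have sa := sin_bezout_neq0 ap bez1; have sb := sin_bezout_neq0 bq bez2.
by rewrite /slope !mulf_neq0 ?invr_eq0 // gt_eqF ?sin_pi_frac_gt0.
Qed.

Let tr_meridian ab rho : component_index p q ab ->
  \det rho.1 = 1 -> \det rho.2 = 1 ->
  \tr rho.1 = (2 * cos (th ab.1))%:C -> \tr rho.2 = (2 * cos (ph ab.2))%:C ->
  \tr (meridian_image r s rho) =
  (2 * cos ((- r)%:~R * th ab.1 + s%:~R * ph ab.2))%:C +
  (slope ab)%:C * (\tr (rho.1 * rho.2) - (2 * cos (th ab.1 + ph ab.2))%:C).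
Proof.
move=> [ap bq _] d1 d2 t1 t2.
by apply: mxtrace_exprz_mul; rewrite ?gt_eqF ?sin_pi_frac_gt0.
Qed.

Let rep_traces ab : [/\ \tr (rep ab).1 = (2 * cos (th ab.1))%:C,
  \tr (rep ab).2 = (2 * cos (ph ab.2))%:C &
  \tr ((rep ab).1 * (rep ab).2) = trace_xy ab].
Proof.
have [t1 t2 t3] := normal_form_traces (cis (th ab.1)) (trace_xy ab) (2 * cos (ph ab.2))%:C.
by split; rewrite // t1 cis_add_inv.
Qed.

Let rep_det ab : \det (rep ab).1 = 1 /\ \det (rep ab).2 = 1.
Proof. exact/normal_form_det/cis_neq0. Qed.

Let rep_meridian ab : component_index p q ab -> \tr (meridian_image r s (rep ab)) = c.
Proof.
move=> abP; have [d1 d2] := rep_det ab; have [t1 t2 t3] := rep_traces ab.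
rewrite (tr_meridian abP) // t3 /trace_xy addrAC subrr add0r.
by rewrite [(slope ab)%:C * _]mulrC divfK ?slope_neq0 // addrC subrK.
Qed.

Let rep_irr ab : component_index p q ab -> irr_reps p q (rep ab).
Proof.
move=> abP; have [ap bq par] := abP.
have [d1 d2] := rep_det ab; have [t1 t2 t3] := rep_traces ab.
(* Evenness of the cosine puts the excluded values of c in the form matching the exponents -r and
   s. *)
have [c1 c2] : c <> (2 * cos (r%:~R * th ab.1 + s%:~R * ph ab.2))%:C /\
               c <> (2 * cos ((- r)%:~R * th ab.1 + s%:~R * ph ab.2))%:C.
  case: ab abP {ap bq par d1 d2 t1 t2 t3} => a b /hc[h1 h2]; split.
    move=> E; apply: h1; rewrite E /th /ph /=; congr (2 * cos _)%:C; ring.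
  move=> E; apply: h2; rewrite E /th /ph /= -cosN mulrNz; congr (2 * cos _)%:C; ring.
split; first split=> //.
  rewrite (mx2_expr_torsion ap d1 t1) (mx2_expr_torsion bq d2 t2).
  by rewrite -signr_odd -[in RHS]signr_odd; move: par; rewrite !modn2 => /eqP; case: odd; case: odd.
have sl0 := slope_neq0 abP.
(* The two reducible values 2 cos(th + ph) and 2 cos(th - ph) of tr rho(xy) correspond under the
   affine relation to the two excluded values of c. *)
apply: normal_form_cis_irreducible => E.
  apply: c2; move/eqP: E; rewrite /trace_xy -subr_eq0 addrAC subrr add0r.
  by rewrite mulf_eq0 invr_eq0 (negPf sl0) orbF subr_eq0 => /eqP.
apply: c1; have := rep_meridian abP; rewrite (tr_meridian abP) // t3 E => <-.
rewrite -rmorphB -rmorphM -rmorphD; congr (_%:C).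
rewrite /slope !mulrNz !mulNr !(cosB, cosD) !cosN !sinN.
by field; rewrite !gt_eqF ?sin_pi_frac_gt0.
Qed.

Let class_rep ab rho : component_index p q ab -> irr_reps p q rho ->
  \tr rho.1 = (2 * cos (th ab.1))%:C -> \tr rho.2 = (2 * cos (ph ab.2))%:C ->
  \tr (meridian_image r s rho) = c -> conj_class rho = conj_class (rep ab).
Proof.
case: rho => A B abP [[/= dA dB _] irr] tA tB tm.
apply: conj_class_eq.
have -> : rep ab = normal_form (cis (th ab.1)) (\tr (A * B)) (\tr B).
  rewrite /rep tB; congr (normal_form _ _ _).
  rewrite /trace_xy -tm (@tr_meridian _ (A, B) abP dA dB tA tB) /=.
  rewrite addrAC subrr add0r mulrAC divff ?slope_neq0 //.
  by rewrite mul1r addrC subrK.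
by apply: conj_normal_form; rewrite ?cis_neq0 // tA cis_add_inv.
Qed.

Let trace_index ab ab' : component_index p q ab -> component_index p q ab' ->
  (2 * cos (th ab.1))%:C = (2 * cos (th ab'.1))%:C :> C ->
  (2 * cos (ph ab.2))%:C = (2 * cos (ph ab'.2))%:C :> C -> ab = ab'.
Proof.
case: ab ab' => a b [a' b'] [/= ap bq _] [/= ap' bq' _].
have two0 : (2 : R) != 0 by rewrite pnatr_eq0.
move=> /complexI/(mulfI two0)/(cos_pi_frac_inj ap ap') ->.
by move=> /complexI/(mulfI two0)/(cos_pi_frac_inj bq bq') ->.
Qed.

(** The traces of x and y recover (a, b), giving injectivity. Every irreducible class has some
    index, and with tr rho(mu) = c its three trace coordinates agree with those of [rep], giving
    surjectivity. *)
Lemma class_rep_bij :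
  set_bij (component_index p q) (classes_with_trace p q r s c)
    (fun ab => conj_class (rep ab)).
Proof.
split.
- move=> ab abP; exists (rep ab) => //.
  by split; [exact: rep_irr | exact: rep_meridian].
- move=> ab ab' /set_mem abP /set_mem abP' /conj_class_traces[].
  have [-> -> _] := rep_traces ab; have [-> -> _] := rep_traces ab'.
  exact: trace_index.
- move=> _ [rho [irr tm] <-].
  have [ab abP [t1 t2]] := irr_rep_component p0 q0 irr.
  by exists ab => //; rewrite (class_rep abP irr).
Qed.

(** Traces are constant on a conjugacy class and determine the index, so the choice in
    [adjoint_torsion] can only return [ab]. *)
Lemma adjoint_torsion_rep (eps : C) ab : component_index p q ab ->
  adjoint_torsion eps p q (conj_class (rep ab)) =
  eps * (verlinde_term R p ab.1 * verlinde_term R q ab.2)%:C.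
Proof.
move=> abP; rewrite /adjoint_torsion.
set P := [set ab' | _]; have -> : xget (0%N, 0%N) P = ab.
  apply: xget_unique.
    split=> //; exists (rep ab) => //.
    by have [t1 t2 _] := rep_traces ab; split=> //; exact: rep_irr.
  move=> ab' [abP' [sigma [_ t1 t2] /conj_class_traces[]]].
  have [-> -> _] := rep_traces ab; rewrite t1 t2.
  exact: trace_index.
congr (_ * _%:C); rewrite /verlinde_term.
have [ap bq _] := abP.
by field; rewrite !gt_eqF ?sin_angle_gt0.
Qed.

Lemma sum_classes (V : nmodType) (f : C -> V) (eps : C) :
  \sum_(X \in classes_with_trace p q r s c) f (adjoint_torsion eps p q X) =
  \sum_(1 <= a < p) \sum_(1 <= b < q | odd a == odd b)
    f (eps * (verlinde_term R p a * verlinde_term R q b)%:C).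
Proof.
rewrite (reindex_fsbig _ _ _ _ class_rep_bij).
(* A duplicate-free list of the indices turns the sum over a finite set into an iterated sum. *)
pose l := [seq ab <- [seq (a, b) | a <- index_iota 1 p, b <- index_iota 1 q]
             | odd ab.1 == odd ab.2].
have lE : component_index p q = [set` l].
  apply/seteqP; split=> -[a b].
    move=> [/= ap bq par]; rewrite /= mem_filter /=; apply/andP; split.
      by move: par; rewrite !modn2; case: odd; case: odd.
    by apply/allpairsP; exists (a, b); rewrite !mem_index_iota.
  rewrite /= mem_filter /= => /andP[/eqP par /allpairsP[[a' b'] /=]].
  rewrite !mem_index_iota => -[ap bq [aE bE]]; subst a' b'.
  by split=> //=; rewrite !modn2 par.
have ul : uniq l.
  by rewrite filter_uniq // allpairs_uniq ?iota_uniq // => -[? ?] [? ?].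
rewrite lE -fsbig_seq //.
rewrite (eq_big_seq (fun ab : nat * nat =>
   f (eps * (verlinde_term R p ab.1 * verlinde_term R q ab.2)%:C))); last first.
  by move=> ab abl; rewrite adjoint_torsion_rep // lE.
rewrite /l big_filter big_mkcond big_allpairs.
by apply: eq_bigr => a _; rewrite -big_mkcond.
Qed.

End Classes.


Theorem mainTheorem4 (R : realType) (p q : nat) (r s : int) (c eps : R[i])
    (m : int)
    (hp : (2 <= p)%N) (hq : (2 <= q)%N) (hpq : coprime p q)
    (hrs : p%:Z * s - q%:Z * r = 1)
    (hc : forall a b : nat, component_index p q (a, b) ->
       c <> (2 * cos (pi * (r%:~R * a%:R / p%:R + s%:~R * b%:R / q%:R)))%:C /\
       c <> (2 * cos (pi * (r%:~R * a%:R / p%:R - s%:~R * b%:R / q%:R)))%:C)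
    (heps : eps = 1 \/ eps = -1)
    (hm : -1 <= m) :
  [/\ (odd p ->
        eps ^ m * \sum_(X \in classes_with_trace p q r s c)
                     adjoint_torsion eps p q X ^ m
          = 2 ^ (- m) * (rankV R p (absz (m + 1)))%:R
                      * (rankV R (2 * q) (absz (m + 1)))%:R
        /\ exists k : int,
             2 ^ (- m) * (rankV R p (absz (m + 1)))%:R
                       * (rankV R (2 * q) (absz (m + 1)))%:R
               = k%:~R / (2 ^ m) :> R[i]),
      (exists k : int,
         \sum_(X \in classes_with_trace p q r s c)
            (2 * adjoint_torsion eps p q X) ^ m = k%:~R) &
      (odd p -> odd q ->
        eps ^ m * \sum_(X \in classes_with_trace p q r s c)
                     adjoint_torsion eps p q X ^ m
          = 2 * (rankV R p (absz (m + 1)))%:R * (rankV R q (absz (m + 1)))%:R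
        /\ exists k : int,
             2 * (rankV R p (absz (m + 1)))%:R * (rankV R q (absz (m + 1)))%:R
               = 2 * k%:~R :> R[i])].
Proof.
have p0 : (0 < p)%N by apply: ltnW.
have q0 : (0 < q)%N by apply: ltnW.
set g := absz (m + 1).
have rankC N : verlinde R N g \is a @Num.nat R ->
    (rankV R N g)%:R = (verlinde R N g)%:C :> R[i].
  by move=> /rankVE <-; rewrite rmorph_nat.
have morphz (x : R) : (x ^ m)%:C = x%:C ^ m by rewrite -fmorphXz.
have sumE (f : R[i] -> R[i]) := sum_classes p0 q0 hrs hc f eps.
have eps2 : eps * eps = 1 by case: heps => ->; rewrite ?mulrNN mulr1.
have sumX (u : R[i]) : \sum_(X \in classes_with_trace p q r s c)
    (u * adjoint_torsion eps p q X) ^ m = u ^ m * eps ^ m * (torsion_sum R p q m)%:C.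
  rewrite (sumE (fun x => (u * x) ^ m)) /torsion_sum rmorph_sum mulr_sumr.
  apply: eq_bigr => a _; rewrite rmorph_sum mulr_sumr; apply: eq_bigr => b _.
  by rewrite (expfzMl u) (expfzMl eps) mulrA -morphz.
(* Each torsion power carries another [eps ^ m], and (eps * eps)^m = 1. *)
have sum1 : eps ^ m * \sum_(X \in classes_with_trace p q r s c)
    adjoint_torsion eps p q X ^ m = (torsion_sum R p q m)%:C.
  rewrite (sumE (fun x => x ^ m)) /torsion_sum rmorph_sum mulr_sumr.
  apply: eq_bigr => a _; rewrite rmorph_sum mulr_sumr; apply: eq_bigr => b _.
  by rewrite (expfzMl eps) mulrA -morphz -expfzMl eps2 exp1rz mul1r.
have two0 : (2 : R[i]) != 0 by rewrite pnatr_eq0.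
have two_m : (2 : R[i]) ^ (- m) * 2 ^ m = 1.
  by rewrite -expfzDr // addNr expr0z.
have torsionC p' q' : odd p' -> (1 < p')%N -> (1 < q')%N ->
    (torsion_sum R p' q' m)%:C =
    2 ^ (- m) * (rankV R p' g)%:R * (rankV R (2 * q') g)%:R.
  move=> oddp p1 q1; rewrite torsion_sum_verlinde // ?(ltnW q1) //.
  rewrite !rankC ?verlinde_double_nat ?verlinde_odd_nat //.
  by rewrite !rmorphM /= fmorphXz rmorph_nat.
split.
- move=> oddp; rewrite sum1 (torsionC _ _ oddp) //; split=> //.
  exists ((rankV R p g)%:Z * (rankV R (2 * q) g)%:Z).
  by rewrite invr_expz intrM -!pmulrn -mulrA mulrC.
- have epsm : exists k : int, eps ^ m = k%:~R.
    case: heps => ->; first by exists 1; rewrite exp1rz.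
    exists ((-1) ^+ (absz m)); rewrite rmorph_sign.
    by case: m {hm g rankC morphz sumE sumX sum1 two_m torsionC} => n //;
      rewrite NegzE -exprnN invr_sign.
  have [k epsk] := epsm.
  (* The factor 2^m cancels the 2^(-m) of (i) and leaves a product of two ranks. *)
  have int_sum p' q' : odd p' -> (1 < p')%N -> (1 < q')%N ->
      exists k : int, 2 ^ m * (torsion_sum R p' q' m)%:C = k%:~R.
    move=> oddp p1 q1; exists ((rankV R p' g)%:Z * (rankV R (2 * q') g)%:Z).
    rewrite torsionC // mulrA mulrA [2 ^ m * _]mulrC two_m mul1r.
    by rewrite intrM -!pmulrn.
  have [l lE] : exists k : int, 2 ^ m * (torsion_sum R p q m)%:C = k%:~R.
    case: (boolP (odd p)) => oddp; first exact: int_sum.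
    (* If p is even, coprimality makes q odd, and p and q exchange roles. *)
    rewrite torsion_sumC; apply: int_sum => //.
    apply: contraT => oddq; have : (2 %| gcdn p q)%N by rewrite dvdn_gcd !dvdn2 oddp.
    by rewrite (eqP hpq).
  by exists (k * l); rewrite sumX mulrAC lE epsk intrM mulrC.
- move=> oddp oddq; rewrite sum1 torsion_sum_verlinde_odd //; split.
    by rewrite !rankC ?verlinde_odd_nat // !rmorphM /= rmorph_nat.
  exists ((rankV R p g)%:Z * (rankV R q g)%:Z).
  by rewrite intrM -!pmulrn mulrA.
Qed.
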